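(* Let $m \ge n$, let $A \in \mathbb{R}^{m\times n}$ have full rank, let $x \in \mathbb{R}^n$ and $b \in \mathbb{R}^m$ satisfy $Ax = b$, let $x_0 \in \mathbb{R}^n$ be an arbitrary deterministic starting vector, and let $(x_k)_{k \ge 0}$ be the random sequence produced by the Randomized Kaczmarz method for $Ax=b$ started at $x_0$. Let $v_\ell \in \mathbb{R}^n$ be a right singular vector of $A$ associated to the singular value $\sigma_\ell$. Then for every integer $k \ge 0$, $$\mathbb{E} \left\langle x_{k} - x, v_{\ell} \right\rangle = \left(1 - \frac{\sigma_{\ell}^2 }{\|A\|_F^2}\right)^k\left\langle x_0 - x, v_{\ell}\right\rangle .$$
   Context: Let $a_1,\dots,a_m \in \mathbb{R}^n$ denote the rows of $A$ and $b_1,\dots,b_m$ the entries of $b$. $\|\cdot\|$ is the Euclidean norm, $\langle\cdot,\cdot\rangle$ the standard inner product, and $\|A\|_F$ the Frobenius norm, so $\|A\|_F^2=\sum_{i=1}^m \|a_i\|^2$. The Randomized Kaczmarz method: given $x_k$, choose an index $i \in \{1,\dots,m\}$ at random, independently of all previous choices, where $i$ is chosen with probability $\|a_i\|^2/\|A\|_F^2$, and set $$x_{k+1} = x_k + \frac{b_i - \langle a_i, x_k\rangle}{\|a_i\|^2}\, a_i .$$ (Zero rows, if any, are chosen with probability $0$.) The singular values of $A$ are $\sigma_1\ge\dots\ge\sigma_n$, with right singular vectors $v_1,\dots,v_n$ (an orthonormal basis of $\mathbb{R}^n$) and orthonormal left singular vectors $u_1,\dots,u_n$, so that $A v_i = \sigma_i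 u_i$. The expectation is over the random index choices in the first $k$ steps. *)

(* Defs.v *)
From mathcomp Require Import all_boot all_order all_algebra.
From mathcomp Require Import all_classical all_reals all_analysis.

Set Implicit Arguments.
Unset Strict Implicit.
Unset Printing Implicit Defensive.

Import Order.TTheory GRing.Theory Num.Theory.

Local Open Scope classical_set_scope.
Local Open Scope ring_scope.

Section LinearAlgebra.
Variable R : realType.

(* The norm that the library puts on matrices is the sup norm, hence the
   explicit Euclidean and Frobenius norms. *)
Definition dotv (n : nat) (u v : 'cV[R]_n) : R := \sum_(i < n) u i 0 * v i 0.

Definition enorm (n : nat) (u : 'cV[R]_n) : R := Num.sqrt (dotv u u).

Definition fnorm (m n : nat) (A : 'M[R]_(m, n)) : R :=
  Num.sqrt (\sum_(i < m) \sum_(j < n) A i j ^+ 2).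

Definition mxrow_vec (m n : nat) (A : 'M[R]_(m, n)) (i : 'I_m) : 'cV[R]_n :=
  (row i A)^T.

Definition orthonormal_family (p n : nat) (w : 'I_p -> 'cV[R]_n) : Prop :=
  forall i j : 'I_p, dotv (w i) (w j) = (i == j)%:R.

(* Thin singular value decomposition of an m x n matrix; the n orthonormal
   vectors v_i in R^n automatically form a basis. *)
Record is_svd (m n : nat) (A : 'M[R]_(m, n)) (sigma : 'I_n -> R)
    (u : 'I_n -> 'cV[R]_m) (v : 'I_n -> 'cV[R]_n) : Prop := IsSVD {
  svd_ge0 : forall i : 'I_n, 0 <= sigma i;
  svd_nonincreasing : forall i j : 'I_n, (i <= j)%N -> sigma j <= sigma i;
  svd_left : orthonormal_family u;
  svd_right : orthonormal_family v;
  svd_eq : forall i : 'I_n, A *m v i = sigma i *: u i }.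

(* When the row is zero the quotient is 0 by the convention 0^-1 = 0, so the
   step is the identity; such a row is selected with probability 0. *)
Definition kaczmarz_step (m n : nat) (A : 'M[R]_(m, n)) (b : 'cV[R]_m)
    (i : 'I_m) (x : 'cV[R]_n) : 'cV[R]_n :=
  let a := mxrow_vec A i in
  x + ((b i 0 - dotv a x) / enorm a ^+ 2) *: a.

Fixpoint kaczmarz (m n : nat) (A : 'M[R]_(m, n)) (b : 'cV[R]_m)
    (x0 : 'cV[R]_n) (idx : nat -> 'I_m) (k : nat) : 'cV[R]_n :=
  match k with
  | 0 => x0
  | k'.+1 => kaczmarz_step A b (idx k') (kaczmarz A b x0 idx k')
  end.

End LinearAlgebra.

Section RandomIndices.
Context (d : measure_display) (T : measurableType d) (R : realType).

(* 'I_m carries the discrete sigma-algebra: every subset is measurable. *)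
Definition mutually_independent (P : probability T R) (m : nat)
    (I : nat -> T -> 'I_m) : Prop :=
  forall (s : seq nat) (B : nat -> set 'I_m), uniq s ->
    P (\bigcap_(j in [set` s]) (I j @^-1` B j)) =
    (\prod_(j <- s) P (I j @^-1` B j))%E.

(* [I k w] is the row used to pass from iterate k to iterate k+1. *)
Record kaczmarz_sampling (P : probability T R) (m n : nat)
    (A : 'M[R]_(m, n)) (I : nat -> T -> 'I_m) : Prop := KaczmarzSampling {
  sampling_measurable :
    forall (k : nat) (B : set 'I_m), measurable (I k @^-1` B);
  sampling_law : forall (k : nat) (i : 'I_m),
    P (I k @^-1` [set i]) = (enorm (mxrow_vec A i) ^+ 2 / fnorm A ^+ 2)%:E;
  sampling_indep : mutually_independent P I }.

End RandomIndices.

(* Main.v *)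
(* Since A^T A v_l = sigma_l^2 v_l, averaging one step over the sampling law
   multiplies <y - x, v_l> by 1 - sigma_l^2 / |A|_F^2, whatever the current
   point y. The expectation after k steps is a finite sum over the k-tuples of
   chosen rows, whose probabilities factor by independence; conditioning on the
   first row and recursing from the point it leads to gives the k-th power. *)
Require Import Defs.
From mathcomp Require Import all_boot all_order all_algebra.
From mathcomp Require Import all_classical all_reals all_analysis.

Set Implicit Arguments.
Unset Strict Implicit.
Unset Printing Implicit Defensive.

Import Order.TTheory GRing.Theory Num.Theory.

Local Open Scope ring_scope.

Section Kaczmarz.
Variable R : realType.

Lemma dotvE n (u v : 'cV[R]_n) : dotv u v = (u^T *m v) 0 0.
Proof. by rewrite mxE; apply: eq_bigr => i _; rewrite mxE. Qed.

Lemma dotvDl n (u v w : 'cV[R]_n) : dotv (u + v) w = dotv u w + dotv v w.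
Proof. by rewrite -big_split; apply: eq_bigr => i _; rewrite mxE mulrDl. Qed.

Lemma dotvZl n a (u v : 'cV[R]_n) : dotv (a *: u) v = a * dotv u v.
Proof. by rewrite mulr_sumr; apply: eq_bigr => i _; rewrite mxE mulrA. Qed.

Lemma dotvZr n a (u v : 'cV[R]_n) : dotv u (a *: v) = a * dotv u v.
Proof. by rewrite mulr_sumr; apply: eq_bigr => i _; rewrite mxE mulrCA. Qed.

Lemma enorm_sqr n (u : 'cV[R]_n) : enorm u ^+ 2 = \sum_i u i 0 ^+ 2.
Proof. by rewrite sqr_sqrtr ?sumr_ge0 // => i _; rewrite -expr2 sqr_ge0. Qed.

Lemma enorm_sqr_eq0 n (u : 'cV[R]_n) : (enorm u ^+ 2 == 0) = (u == 0).
Proof.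
rewrite enorm_sqr; apply/eqP/eqP => [u0|->]; last first.
  by rewrite big1 // => i _; rewrite mxE expr0n.
apply/matrixP => i j; rewrite ord1 mxE; apply/eqP; rewrite -sqrf_eq0; apply/eqP.
by apply: (psumr_eq0P _ u0) => // ? _; exact: sqr_ge0.
Qed.

Lemma fnorm_sqr m n (A : 'M[R]_(m, n)) :
  fnorm A ^+ 2 = \sum_i enorm (mxrow_vec A i) ^+ 2.
Proof.
rewrite sqr_sqrtr; last by do 2![apply: sumr_ge0 => ? _]; exact: sqr_ge0.
apply: eq_bigr => i _; rewrite enorm_sqr.
by apply: eq_bigr => j _; rewrite !mxE.
Qed.

Lemma fnorm_sqr_eq0 m n (A : 'M[R]_(m, n)) : (fnorm A ^+ 2 == 0) = (A == 0).
Proof.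
rewrite fnorm_sqr; apply/eqP/eqP => [A0|->]; last first.
  by rewrite big1 // => i _; apply/eqP; rewrite enorm_sqr_eq0 /mxrow_vec row0 trmx0.
apply/row_matrixP => i; rewrite row0; apply: trmx_inj; rewrite trmx0.
apply/eqP; rewrite -enorm_sqr_eq0; apply/eqP.
by apply: (psumr_eq0P _ A0) => // ? _; exact: sqr_ge0.
Qed.

Lemma dotv_row m n (A : 'M[R]_(m, n)) i (y : 'cV[R]_n) :
  dotv (mxrow_vec A i) y = (A *m y) i 0.
Proof. by rewrite mxE; apply: eq_bigr => j _; rewrite !mxE. Qed.

(** Both sides have the same coordinates in the orthonormal basis [v]: the inner product of
    [A *m v j] with [A *m v l] is [sigma j * sigma l] times that of [u j] with [u l], hence vanishes
    unless [j = l]. *)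
Lemma svd_gram m n (A : 'M[R]_(m, n)) sigma u v (l : 'I_n) :
  is_svd A sigma u v -> A^T *m (A *m v l) = sigma l ^+ 2 *: v l.
Proof.
move=> [_ _ u1 v1 Av].
pose V : 'M[R]_n := \matrix_(i, j) v j i 0.
have colV j : col j V = v j.
  by apply/matrixP => i k; rewrite !mxE ord1.
have VV : V^T *m V = 1%:M.
  apply/matrixP => i j; rewrite mxE [RHS]mxE -v1.
  by apply: eq_bigr => k _; rewrite !mxE.
suff: V^T *m (A^T *m (A *m v l)) = V^T *m (sigma l ^+ 2 *: v l).
  (* [V] is square, so its left inverse [V^T] is also a right inverse, and multiplying by [V]
     cancels [V^T] on both sides. *)
  by move=> /(congr1 (mulmx V)); rewrite !mulmxA (mulmx1C VV) !mul1mx.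
apply/matrixP => j k; rewrite ord1 {k} mulmxA -trmx_mul -scalemxAr [RHS]mxE.
have -> : ((A *m V)^T *m (A *m v l)) j 0 = dotv (A *m v j) (A *m v l).
  by rewrite -dotv_row /mxrow_vec -tr_col trmxK -(colV j) !colE mulmxA.
have -> : (V^T *m v l) j 0 = dotv (v j) (v l).
  by rewrite -dotv_row /mxrow_vec -tr_col trmxK colV.
rewrite !Av dotvZl dotvZr u1 v1.
by case: eqVneq => [->|_]; rewrite ?mulr1 ?mulr0 // expr2.
Qed.

(* The factor [enorm a ^+ 2] makes the identity hold for a zero row too. *)
Lemma dotv_kaczmarz_step m n (A : 'M[R]_(m, n)) (x y z : 'cV[R]_n) (i : 'I_m) :
  enorm (mxrow_vec A i) ^+ 2 * dotv (kaczmarz_step A (A *m x) i y - x) z =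
  enorm (mxrow_vec A i) ^+ 2 * dotv (y - x) z -
  (A *m (y - x)) i 0 * (A *m z) i 0.
Proof.
rewrite -[(A *m z) i 0]dotv_row /kaczmarz_step dotv_row.
set a := mxrow_vec A i; set c := _ / _.
have -> : (A *m (y - x)) i 0 = - ((A *m x) i 0 - (A *m y) i 0).
  by rewrite mulmxBr !mxE opprB.
have -> : dotv (y + c *: a - x) z = dotv (y - x) z + c * dotv a z.
  by rewrite addrAC [LHS]dotvDl dotvZl.
rewrite mulrDr mulNr opprK; congr (_ + _); rewrite mulrA.
have [/eqP|a0] := eqVneq (enorm a ^+ 2) 0; last by rewrite [_ * c]mulrC divfK.
rewrite enorm_sqr_eq0 => /eqP ->.
by rewrite dotvE trmx0 mul0mx mxE !mulr0.
Qed.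

(** The weights cancel the denominators of the steps, so the corrections add up to the inner product
    of [A *m (y - x)] with [A *m z]; moving [A] across turns it into [c * dotv (y - x) z]. *)
Lemma mean_kaczmarz_step m n (A : 'M[R]_(m, n)) (x y z : 'cV[R]_n) (c : R) :
  A != 0 -> A^T *m (A *m z) = c *: z ->
  \sum_i enorm (mxrow_vec A i) ^+ 2 / fnorm A ^+ 2 *
    dotv (kaczmarz_step A (A *m x) i y - x) z =
  (1 - c / fnorm A ^+ 2) * dotv (y - x) z.
Proof.
rewrite -fnorm_sqr_eq0 => F0 Az.
under eq_bigr do rewrite mulrAC dotv_kaczmarz_step.
rewrite -mulr_suml sumrB -mulr_suml -fnorm_sqr.
have -> : \sum_i (A *m (y - x)) i 0 * (A *m z) i 0 = c * dotv (y - x) z.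
  rewrite -[LHS]/(dotv (A *m (y - x)) (A *m z)) !dotvE trmx_mul -mulmxA Az.
  by rewrite -scalemxAr mxE.
by rewrite -mulrBl mulrAC mulrBl divff.
Qed.

(** The head of [s] is the first row used, so prepending a row only changes the starting point; the
    induction on tuples rests on this. *)
Definition kaczmarz_seq m n (A : 'M[R]_(m, n)) b (x0 : 'cV[R]_n) (s : seq 'I_m) :=
  foldl (fun y i => kaczmarz_step A b i y) x0 s.

Lemma kaczmarz_seqE m n (A : 'M[R]_(m, n)) b x0 (idx : nat -> 'I_m) k :
  kaczmarz A b x0 idx k = kaczmarz_seq A b x0 [tuple idx j | j < k].
Proof.
(* Over [iota] the last index splits off with [rcons], matching the recursion of [kaczmarz], which
   adds its newest step at the end. *)
have -> : val [tuple idx j | j < k] = [seq idx j | j <- iota 0 k].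
  by rewrite /= -val_enum_ord -map_comp.
elim: k => [|k IH] //.
have -> : iota 0 k.+1 = rcons (iota 0 k) k by rewrite -cats1 -addn1 iotaD.
by rewrite map_rcons /kaczmarz_seq foldl_rcons /= IH.
Qed.

Lemma big_tuple_cons (I : finType) k (F : k.+1.-tuple I -> R) :
  \sum_t F t = \sum_i \sum_(t : k.-tuple I) F [tuple of i :: t].
Proof.
rewrite pair_big (reindex (fun p : I * k.-tuple I => [tuple of p.1 :: p.2])) //=.
exists (fun t => (thead t, [tuple of behead t])) => [[i t] _|t _] /=.
  by congr pair; apply: val_inj.
by rewrite -tuple_eta.
Qed.

Lemma mean_kaczmarz_seq m n (A : 'M[R]_(m, n)) (x z : 'cV[R]_n) (c : R) k y :
  A != 0 -> A^T *m (A *m z) = c *: z ->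
  \sum_(t : k.-tuple 'I_m) dotv (kaczmarz_seq A (A *m x) y t - x) z *
    \prod_(i <- t) (enorm (mxrow_vec A i) ^+ 2 / fnorm A ^+ 2) =
  (1 - c / fnorm A ^+ 2) ^+ k * dotv (y - x) z.
Proof.
move=> A0 Az; elim: k y => [|k IH] y.
  rewrite (big_pred1 [tuple]) => [|t]; last exact/esym/eqP/tuple0.
  by rewrite big_nil mulr1 mul1r.
(* One factor of the power is expanded back into the average over the first row; the induction
   hypothesis then applies at the point this row leads to. *)
rewrite big_tuple_cons [_ ^+ k.+1]exprSr -mulrA -mean_kaczmarz_step // mulr_sumr.
apply: eq_bigr => i _; rewrite mulrCA -IH mulr_sumr.
by apply: eq_bigr => t _; rewrite big_cons mulrCA.
Qed.

End Kaczmarz.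

Section Expectation.
Local Open Scope classical_set_scope.

(** The first [k] draws take finitely many values, so the integrand is a finite combination of
    indicators and the integral is computed by linearity. *)
Lemma expectation_iid_tuple (R : realType) (d : measure_display)
  (T : measurableType d) (P : probability T R) (m : nat) (I : nat -> T -> 'I_m)
  (p : 'I_m -> R) (mI : forall k (B : set 'I_m), measurable (I k @^-1` B))
  (pI : forall k i, P (I k @^-1` [set i]) = (p i)%:E)
  (indI : mutually_independent P I) k (g : k.-tuple 'I_m -> R) :
  ('E_P[fun w => g [tuple I j w | j < k]] =
   (\sum_t g t * \prod_(i <- t) p i)%:E)%E.
Proof.
(* Taking [i] itself as the default of [nth] avoids a choice of default. *)
pose B (t : k.-tuple 'I_m) (j : nat) : set 'I_m := [set i | nth i t j = i].
(* [E t] is the event that the first [k] draws spell [t], written over natural indices to fit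
   [mutually_independent]. *)
pose E t : set T := \bigcap_(j in [set` iota 0 k]) (I j @^-1` B t j).
have BE t (j : 'I_k) : B t j = [set tnth t j].
  by apply/seteqP; split => i; rewrite /B /= (tnth_nth i).
have mE t : measurable (E t).
  by apply: fin_bigcap_measurable => [|j _]; [exact: finite_seq | exact: mI].
have PE t : P (E t) = (\prod_(i <- t) p i)%:E.
  rewrite indI ?iota_uniq // -[k in iota 0 k]subn0 big_mkord.
  by rewrite big_tuple -prodEFin; apply: eq_bigr => j _; rewrite BE pI.
have memE t w : (w \in E t) = (t == [tuple I j w | j < k]).
  apply/idP/eqP => [|->]; rewrite inE.
    move=> Ew; apply: eq_from_tnth => j; rewrite tnth_mktuple.
    have /= := Ew j; rewrite mem_iota ltn_ord BE => /(_ isT) /= ->//.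
  move=> j /=; rewrite mem_iota /= => jk.
  by rewrite -[j]/(val (Ordinal jk)) BE /= tnth_mktuple.
(* Each [w] lies in exactly one [E t], the one for the tuple actually drawn. *)
have gE w : (g [tuple I j w | j < k])%:E =
    (\sum_t (g t)%:E * (\1_(E t) w)%:E)%E.
  rewrite (bigD1 [tuple I j w | j < k]) //= indicE memE eqxx mule1.
  rewrite big1 ?adde0 // => t /negPf tw.
  by rewrite indicE memE tw mule0.
have iE t : P.-integrable [set: T] (fun w => (\1_(E t) w)%:E).
  exact: integrable_indic.
rewrite unlock; under eq_integral do rewrite gE.
rewrite integral_sum // => [|t]; last exact: integrableZl.
rewrite -sumEFin; apply: eq_bigr => t _.
by rewrite EFinM -PE integralZl // integral_indic // setIT.
Qed.

End Expectation.

Theorem theorem1 (R : realType) (m n : nat) (hmn : (n <= m)%N)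
  (A : 'M[R]_(m, n)) (hA : \rank A = minn m n)
  (x : 'cV[R]_n) (b : 'cV[R]_m) (hb : A *m x = b) (x0 : 'cV[R]_n)
  (d : measure_display) (T : measurableType d) (P : probability T R)
  (I : nat -> T -> 'I_m) (hI : kaczmarz_sampling P A I)
  (sigma : 'I_n -> R) (u : 'I_n -> 'cV[R]_m) (v : 'I_n -> 'cV[R]_n)
  (hsvd : is_svd A sigma u v) (l : 'I_n) (k : nat) :
  ('E_P[fun w : T => dotv (kaczmarz A b x0 (fun j => I j w) k - x) (v l)] =
   ((1 - sigma l ^+ 2 / fnorm A ^+ 2) ^+ k * dotv (x0 - x) (v l))%:E)%E.
Proof.
(* The index [l] forces [0 < n], so the rank of [A], which is [n], is positive. *)
have A0 : A != 0.
  by rewrite -mxrank_eq0 hA (minn_idPr hmn) -lt0n (leq_ltn_trans _ (ltn_ord l)).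
have [mI lawI indI] := hI; rewrite -hb.
under eq_fun do rewrite kaczmarz_seqE.
rewrite (expectation_iid_tuple mI lawI indI
  (fun t => dotv (kaczmarz_seq A (A *m x) x0 t - x) (v l))).
by rewrite (mean_kaczmarz_seq _ _ _ A0 (svd_gram l hsvd)).
Qed.
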